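(* Let $G=(V,E)$ be a critical graph, i.e., all its edges are critical. Then $\vartheta\text{-rank}(G)=0$ if and only if $G$ is the disjoint union of $\alpha(G)$ cliques. In particular, $\vartheta\text{-rank}(G)=0$ if and only if $\overline\chi(G)=\alpha(G)$.
   Context: All graphs are finite and simple with nonempty vertex set. For a graph $G=(V=[n],E)$, $\alpha(G)$ is the maximum cardinality of a stable (independent) set, $\overline\chi(G)$ is the minimum number of cliques of $G$ whose union is $V$, $A_G$ is the adjacency matrix, $I$ the identity and $J$ the all-ones matrix. An edge $e$ is critical if $\alpha(G\setminus e)=\alpha(G)+1$, where $G\setminus e$ is obtained by deleting the edge $e$. For $r\in\mathbb N=\{0,1,\dots\}$, $\mathcal K_n^{(r)}$ is the set of real symmetric $n\times n$ matrices $M$ such that $(\sum_{i=1}^n x_i^2)^r\sum_{i,j=1}^n M_{ij}x_i^2x_j^2$ is a sum of squares of real polynomials. The $\vartheta$-rank of $G$, $\vartheta\text{-rank}(G)$, is the smallest $r\in\mathbb N$ with $\alpha(G)(A_G+I)-J\in\mathcal K_n^{(r)}$, and $\infty$ if no such $r$ exists. ''Disjoint union of cliques'' means that the connected components of $G$ are complete graphs (an isolated node is a clique of size one). *)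

(* Defs.v *)
From mathcomp Require Import all_boot all_order all_algebra.
From mathcomp Require Import boolp reals.
From mathcomp Require Import mpoly.

Set Implicit Arguments.
Unset Strict Implicit.
Unset Printing Implicit Defensive.

Import Order.TTheory GRing.Theory Num.Theory.

Record sgraph (n : nat) := SGraph {
  adj :> rel 'I_n;
  adj_sym : ssrbool.symmetric adj;
  adj_irr : irreflexive adj }.

Section Graphs.
Variable n : nat.
Implicit Types (G : sgraph n) (u v : 'I_n) (S : {set 'I_n}).

Definition stable G S : bool := [forall x in S, forall y in S, ~~ G x y].

Definition clique G S : bool :=
  [forall x in S, forall y in S, (x != y) ==> G x y].

Definition alpha G : nat := \max_(S : {set 'I_n} | stable G S) #|S|.

Definition clique_cover G (P : {set {set 'I_n}}) : bool :=
  [forall C in P, clique G C] && (cover P == [set: 'I_n]).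

Definition singletons : {set {set 'I_n}} := [set [set x] | x : 'I_n].

(* Makes the [arg min] below meaningful: its default value is a cover. *)
Lemma singletons_cover G : clique_cover G singletons.
Proof.
apply/andP; split.
  apply/forall_inP => C /imsetP[z _ ->].
  apply/forall_inP => x /set1P ->; apply/forall_inP => y /set1P ->.
  by rewrite eqxx.
apply/eqP/setP => x; rewrite inE; apply/bigcupP; exists [set x].
  exact: imset_f.
exact: set11.
Qed.

Definition clique_cover_number G : nat :=
  #|[arg min_(P < singletons | clique_cover G P) #|P|]|.

Definition del_edge_rel G u v : rel 'I_n :=
  fun x y => G x y && ([set x; y] != [set u; v]).

Lemma del_edge_sym G u v : ssrbool.symmetric (del_edge_rel G u v).
Proof. by move=> x y; rewrite /del_edge_rel adj_sym setUC. Qed.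

Lemma del_edge_irr G u v : irreflexive (del_edge_rel G u v).
Proof. by move=> x; rewrite /del_edge_rel adj_irr. Qed.

Definition del_edge G u v : sgraph n :=
  SGraph (del_edge_sym G u v) (del_edge_irr G u v).

Definition critical_edge G u v : Prop :=
  G u v /\ alpha (del_edge G u v) = (alpha G).+1.

Definition critical_graph G : Prop :=
  forall u v, G u v -> critical_edge G u v.

Definition components G : {set {set 'I_n}} :=
  [set [set y | connect G x y] | x : 'I_n].

Definition disjoint_union_of_cliques G (k : nat) : Prop :=
  (forall C, C \in components G -> clique G C) /\ #|components G| = k.

End Graphs.

Section ThetaRank.
Local Open Scope ring_scope.
Variables (R : realType) (n : nat).

Definition is_sos (p : {mpoly R[n]}) : Prop :=
  exists s : seq {mpoly R[n]}, p = \sum_(q <- s) q ^+ 2.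

Definition coneK (r : nat) (M : 'M[R]_n) : Prop :=
  M^T = M /\
  is_sos ((\sum_(i < n) 'X_i ^+ 2) ^+ r *
          \sum_(i < n) \sum_(j < n) (M i j *: ('X_i ^+ 2 * 'X_j ^+ 2))).

Definition adj_mx (G : sgraph n) : 'M[R]_n := \matrix_(i, j) (G i j)%:R.

Definition graph_mx (G : sgraph n) : 'M[R]_n :=
  (alpha G)%:R *: (adj_mx G + 1%:M) - const_mx 1.

(* None stands for infinity. *)
Definition theta_rank (G : sgraph n) : option nat :=
  match pselect (exists r : nat, `[< coneK r (graph_mx G) >]) with
  | left exr => Some (ex_minn exr)
  | right _ => None
  end.

End ThetaRank.

(* Main.v *)
Require Import Defs.
From mathcomp Require Import all_boot all_order all_algebra.
From mathcomp Require Import boolp reals.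
From mathcomp Require Import mpoly zify.

(* Comparing coefficients in a sum of squares sum_q q^2 = sum M_ij x_i^2 x_j^2
   shows that M dominates entrywise a positive semidefinite matrix P with the
   same diagonal, the Gram matrix of the vectors c_i = (q_[x_i^2])_q.  For
   M = alpha (A + I) - J and S stable of maximum size, the entries of M on S sum
   to 0, so sum_(i in S) c_i = 0.  The endpoints u, v of a critical edge extend
   a common set T to maximum stable sets T + u and T + v, hence c_u = c_v.  If
   every edge is critical then c is constant on each component, so M_xy >= P_xy
   = M_xx = alpha - 1 > -1 for x, y connected, which forces x and y to be equal
   or adjacent.  Conversely, a cover by alpha cliques provides an explicit
   sum-of-squares decomposition. *)

Set Implicit Arguments.
Unset Strict Implicit.
Unset Printing Implicit Defensive.

Import Order.TTheory GRing.Theory Num.Theory.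
Local Open Scope ring_scope.

(** * Coefficients of a square at the exponents of [X_i^2 X_j^2] *)

Section SquareCoefficients.
Variables (R : realType) (n : nat).
Implicit Types (p : {mpoly R[n]}) (m a b : 'X_{1..n}).

Lemma mcoeff_sqr_diag p m :
    (forall a b, (a + b = m + m)%MM -> a != m -> p@_a * p@_b = 0) ->
  (p ^+ 2)@_(m + m) = p@_m ^+ 2.
Proof.
move=> offdiag; rewrite !expr2 mcoeffM.
have ltm : (mdeg m < (mdeg (m + m)%MM).+1)%N by rewrite mdegD ltnS leq_addr.
rewrite (bigD1 (BMultinom ltm, BMultinom ltm)) //= big1 ?addr0 // => -[a b] /=.
case/andP=> /eqP eq_ab ne; apply: offdiag; first by rewrite -eq_ab.
apply: contraNneq ne => eq_am; rewrite eq_am in eq_ab.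
rewrite xpair_eqE; apply/andP; split; apply/eqP/val_inj; first exact: eq_am.
exact: esym (addmI eq_ab).
Qed.

(** The pairs [(a, b)] and [(b, a)] are two distinct terms of the convolution and give the doubled
    product; the hypothesis makes all other terms nonnegative. *)
Lemma mcoeff_sqr_cross p a b : a != b ->
    (forall c d, (c + d = a + b)%MM -> c != a -> c != b -> 0 <= p@_c * p@_d) ->
  (p@_a * p@_b) *+ 2 <= (p ^+ 2)@_(a + b).
Proof.
move=> neq_ab offdiag; rewrite expr2 mcoeffM.
have lta : (mdeg a < (mdeg (a + b)%MM).+1)%N by rewrite mdegD ltnS leq_addr.
have ltb : (mdeg b < (mdeg (a + b)%MM).+1)%N by rewrite mdegD ltnS leq_addl.
rewrite (bigD1 (BMultinom lta, BMultinom ltb)) //=.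
rewrite (bigD1 (BMultinom ltb, BMultinom lta)) /=; last first.
  apply/andP; split; first by rewrite [X in _ == X]addmC.
  by apply: contraNneq neq_ab => -[->].
rewrite addrA [p@_b * _]mulrC -mulr2n lerDl sumr_ge0 // => -[c d] /=.
case/andP=> /andP[/eqP eq_cd ne1] ne2; apply: offdiag; first by rewrite -eq_cd.
  apply: contraNneq ne1 => eq_ca; rewrite eq_ca in eq_cd.
  rewrite xpair_eqE; apply/andP; split; apply/eqP/val_inj; first exact: eq_ca.
exact: esym (addmI eq_cd).
apply: contraNneq ne2 => eq_cb; rewrite eq_cb in eq_cd.
rewrite xpair_eqE; apply/andP; split; apply/eqP/val_inj; first exact: eq_cb.
exact: esym (addmI (etrans (addmC b a) eq_cd)).
Qed.

Definition sqU (i : 'I_n) : 'X_{1..n} := (U_(i) + U_(i))%MM.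

Lemma mdeg_sqU i : mdeg (sqU i) = 2%N.
Proof. by rewrite mdegD mdeg1. Qed.

Lemma sqU_inj : injective sqU.
Proof.
move=> i j /mnmP /(_ i); rewrite !mnmDE !mnm1E eqxx.
by case: (j =P i).
Qed.

Lemma sqUD_eq i j k l :
  (sqU i + sqU j == sqU k + sqU l)%MM
    = ((i == k) && (j == l)) || ((i == l) && (j == k)).
Proof.
apply/idP/idP; last first.
  by case/orP => /andP[/eqP-> /eqP->]; rewrite // addmC.
move=> /eqP/mnmP eq; move: (eq i) (eq j).
rewrite !mnmDE !mnm1E !eqxx [k == i]eq_sym [l == i]eq_sym [k == j]eq_sym.
rewrite [l == j]eq_sym [j == i]eq_sym; clear eq.
(* Transitivity of equality, lost once the comparisons become independent booleans, rules out the
   spurious cases. *)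
have excl x : i == x -> j == x -> i == j by move=> /eqP-> /eqP->.
move: (excl k) (excl l).
by case: (i == k); case: (j == k); case: (i == l); case: (j == l);
  case: (i == j) => //= excl_k excl_l;
  (move: (excl_k isT isT) || move: (excl_l isT isT)).
Qed.

Lemma mdeg_supp2 m i j : i != j ->
  (forall x, x != i -> x != j -> m x = 0%N) -> mdeg m = (m i + m j)%N.
Proof.
move=> neq_ij supp; rewrite mdegE (bigD1 i) //= (bigD1 j) 1?eq_sym //=.
by rewrite big1 ?addn0 // => x /andP[]; apply: supp.
Qed.

(** Both exponents are supported on [{i, j}], so for distinct [i], [j] the degree-two [a] is [2e_i],
    [2e_j] or [e_i + e_j]; in the last case [b] is [e_i + e_j] too. *)
Lemma sqUD_split a b i j :
    (a + b = sqU i + sqU j)%MM -> mdeg a = 2%N -> mdeg b = 2%N ->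
  [\/ a = sqU i, a = sqU j | a = b].
Proof.
move=> /mnmP eq da db.
have off x : x != i -> x != j -> a x = 0%N /\ b x = 0%N.
  move=> xi xj; move: (eq x); rewrite !mnmDE !mnm1E.
  by rewrite [i == x]eq_sym [j == x]eq_sym (negPf xi) (negPf xj); lia.
case: (i =P j) => [eq_ij|/eqP neq_ij].
  subst j; constructor 1; apply/mnmP => x; rewrite mnmDE mnm1E.
  have ai : a i = 2%N.
    rewrite -da mdegE (bigD1 i) //= big1 ?addn0 // => y ne.
    by case: (off y).
  by case: (i =P x) => [<-//|/eqP]; rewrite eq_sym => ne; case: (off x).
have := mdeg_supp2 neq_ij (fun x xi xj => proj1 (off x xi xj)).
have := mdeg_supp2 neq_ij (fun x xi xj => proj2 (off x xi xj)).
rewrite da db => db' da'; move: (eq i) (eq j).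
rewrite !mnmDE !mnm1E !eqxx [j == i]eq_sym (negPf neq_ij) => eqi eqj.
have cases x : [\/ x = i, x = j | x != i /\ x != j].
  case: (x =P i) => [->|xi]; first by constructor 1.
  case: (x =P j) => [->|xj]; first by constructor 2.
  by constructor 3; split; apply/eqP.
(* The degree being two, the exponent of [a] at [i] determines [a]. *)
have : [\/ a i = 2, a i = 0 | a i = 1]%N.
  by case: (a i) eqi => [|[|[|k]]];
    [constructor 2 | constructor 3 | constructor 1 | lia].
case=> ai; [constructor 1|constructor 2|constructor 3]; apply/mnmP => x;
  rewrite ?mnmDE ?mnm1E; case: (cases x) => [->|->|[xi xj]];
  rewrite ?eqxx ?[j == i]eq_sym ?(negPf neq_ij);
  try (have [ax bx] := off x xi xj;
       rewrite ?ax ?bx ?[i == x]eq_sym ?[j == x]eq_sym ?(negPf xi)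
               ?(negPf xj)); lia.
Qed.

Definition low_vanishing p := forall m, (mdeg m <= 1)%N -> p@_m = 0.

(** The degrees of [a] and [b] add up to four, so either one is at most one and its coefficient
    vanishes, or both are two. *)
Lemma mcoeff_sqU_decomp p a b i j :
    low_vanishing p -> (a + b = sqU i + sqU j)%MM ->
  [\/ a = sqU i, a = sqU j, a = b | p@_a * p@_b = 0].
Proof.
move=> low eq; have := congr1 mdeg eq; rewrite !mdegD !mdeg1 => deg.
case: (leqP (mdeg a) 1) => [/low ->|a2]; first by constructor 4; rewrite mul0r.
case: (leqP (mdeg b) 1) => [/low ->|b2]; first by constructor 4; rewrite mulr0.
have [da db] : mdeg a = 2%N /\ mdeg b = 2%N by lia.
by case: (sqUD_split eq da db);
  [constructor 1 | constructor 2 | constructor 3].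
Qed.

Lemma mcoeff_sqr_quartic p i : low_vanishing p ->
  (p ^+ 2)@_(sqU i + sqU i) = p@_(sqU i) ^+ 2.
Proof.
move=> low; apply: mcoeff_sqr_diag => a b eq ne.
case: (mcoeff_sqU_decomp low eq) => // eq_a; try by rewrite eq_a eqxx in ne.
(* Halving [a + a = sqU i + sqU i] gives [a = sqU i]. *)
case/eqP: ne; subst b; apply/mnmP => x; move/mnmP/(_ x): eq.
by rewrite !mnmDE; lia.
Qed.

(** The inequality comes from the splitting [a = b], that is from the monomial [X_i X_j] of [p],
    which contributes a square. *)
Lemma mcoeff_sqr_mixed p i j : low_vanishing p -> i != j ->
  (p@_(sqU i) * p@_(sqU j)) *+ 2 <= (p ^+ 2)@_(sqU i + sqU j).
Proof.
move=> low ne; apply: mcoeff_sqr_cross => [|a b eq nei nej].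
  by rewrite (inj_eq sqU_inj).
case: (mcoeff_sqU_decomp low eq) => [eq_a|eq_a|->|->//].
- by rewrite eq_a eqxx in nei.
- by rewrite eq_a eqxx in nej.
- by rewrite -expr2 sqr_ge0.
Qed.

End SquareCoefficients.

(** * Sums of squares equal to a quadratic form in the squared variables *)

Section Quartic.
Variables (R : realType) (n : nat).
Implicit Types (M : 'M[R]_n) (s : seq {mpoly R[n]}).

Definition quartic M : {mpoly R[n]} :=
  \sum_(i < n) \sum_(j < n) (M i j *: ('X_i ^+ 2 * 'X_j ^+ 2)).

Lemma mcoeff_quartic M m :
  (quartic M)@_m =
    \sum_(i < n) \sum_(j < n) M i j * (sqU i + sqU j == m)%MM%:R.
Proof.
rewrite raddf_sum; apply: eq_bigr => i _; rewrite raddf_sum.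
apply: eq_bigr => j _.
by rewrite /= mcoeffZ !expr2 -!mpolyXD mcoeffX.
Qed.

Lemma mcoeff_quartic_low M m : (mdeg m < 4)%N -> (quartic M)@_m = 0.
Proof.
move=> lt; rewrite mcoeff_quartic big1 // => i _; rewrite big1 // => j _.
case: eqP => [eq|]; last by rewrite mulr0.
by rewrite -eq mdegD !mdeg_sqU in lt.
Qed.

Lemma mcoeff_quartic_diag M i : (quartic M)@_(sqU i + sqU i) = M i i.
Proof.
rewrite mcoeff_quartic (bigD1 i) //= (bigD1 i) //= eqxx mulr1.
rewrite !big1 ?addr0 // => [j ne|j ne].
  rewrite big1 // => k _; rewrite sqUD_eq (negPf ne) mulr0 //.
by rewrite sqUD_eq (negPf ne) /= andbF mulr0.
Qed.

Lemma mcoeff_quartic_mixed M i j : M^T = M -> i != j ->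
  (quartic M)@_(sqU i + sqU j) = M i j *+ 2.
Proof.
move=> symM ne; have ne' : j != i by rewrite eq_sym.
have Mji : M j i = M i j by rewrite -[in LHS]symM mxE.
rewrite mcoeff_quartic (bigD1 i) //= [X in _ + X](bigD1 j) //= addrA.
rewrite [X in _ + X]big1 ?addr0 => [|k /andP[ki kj]]; last first.
  by rewrite big1 // => l _; rewrite sqUD_eq (negPf ki) (negPf kj) mulr0.
rewrite (bigD1 j) //= [X in _ + X + _]big1 => [|k kj]; last first.
  by rewrite sqUD_eq (negPf kj) (negPf ne) andbF mulr0.
rewrite [X in _ + X](bigD1 i) //= [X in _ + _ + (_ + X)]big1 => [|k ki].
  by rewrite !sqUD_eq !eqxx orbT !mulr1 !addr0 Mji mulr2n.
by rewrite sqUD_eq (negPf ki) (negPf ne') andbF mulr0.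
Qed.

Lemma sum_sqr_eq0 (I : eqType) (r : seq I) (F : I -> R) :
  \sum_(x <- r) F x ^+ 2 = 0 -> forall x, x \in r -> F x = 0.
Proof.
move=> /eqP; rewrite psumr_eq0 => [/allP eq0 x xr|x _]; last exact: sqr_ge0.
by apply/eqP; rewrite -sqrf_eq0; exact: eq0.
Qed.

(** The quartic has no terms of degree below four. Its constant term is the sum of the squared
    constant coefficients, which thus vanish; its coefficient at [X_i^2] is then the sum of the
    squared linear coefficients. *)
Lemma sos_quartic_low M s : quartic M = \sum_(q <- s) q ^+ 2 ->
  forall q, q \in s -> low_vanishing q.
Proof.
move=> eq_s; have const q : q \in s -> q@_0%MM = 0.
  apply: sum_sqr_eq0.
  rewrite -[RHS](mcoeff_quartic_low M (m := 0%MM)) ?mdeg0 //.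
  rewrite eq_s raddf_sum; apply: eq_bigr => p _ /=.
  rewrite -[in RHS](addm0 0%MM) mcoeff_sqr_diag // => a b.
  by rewrite addm0 => /eqP; rewrite mnmD_eq0 => /andP[/eqP-> _]; rewrite eqxx.
have lin i q : q \in s -> q@_U_(i)%MM = 0.
  apply: sum_sqr_eq0.
  rewrite -[RHS](mcoeff_quartic_low M (m := sqU i)) ?mdeg_sqU //.
  rewrite eq_s raddf_sum; apply: eq_big_seq => p ps /=.
  rewrite mcoeff_sqr_diag // => a b eq ne.
  have := congr1 mdeg eq; rewrite !mdegD !mdeg1 => deg.
  case: (posnP (mdeg a)) => [/eqP|a_gt0].
    by rewrite mdeg_eq0 => /eqP->; rewrite const ?mul0r.
  case: (posnP (mdeg b)) => [/eqP|b_gt0].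
    by rewrite mdeg_eq0 => /eqP->; rewrite const ?mulr0.
  (* Here [a] is some [U_(k)] below [2U_(i)], which forces [k = i]. *)
  have /mdeg1P[k /eqP ak] : mdeg a == 1%N by lia.
  case/eqP: ne; rewrite ak; congr mnm1; apply/eqP.
  move/mnmP/(_ k): eq; rewrite ak !mnmDE !mnm1E eqxx.
  by rewrite eq_sym; case: (k == i) => //; lia.
move=> q qs m; rewrite leq_eqVlt ltnS leqn0 => /orP[/mdeg1P[i /eqP->]|].
  exact: lin.
by rewrite mdeg_eq0 => /eqP->; apply: const.
Qed.

(* The Gram matrix of the vectors [c q] is the positive semidefinite part of
   Parrilo's decomposition: it agrees with [M] on the diagonal. *)
Lemma sos_quartic_gram M : M^T = M -> is_sos (quartic M) ->
  exists (s : seq {mpoly R[n]}) (c : {mpoly R[n]} -> 'I_n -> R),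
    (forall i, \sum_(q <- s) c q i ^+ 2 = M i i) /\
    (forall i j, \sum_(q <- s) c q i * c q j <= M i j).
Proof.
move=> symM [s eq_s]; have low := sos_quartic_low eq_s.
pose c (q : {mpoly R[n]}) i := q@_(sqU i).
have diag i : \sum_(q <- s) c q i ^+ 2 = M i i.
  rewrite -mcoeff_quartic_diag eq_s raddf_sum; apply: eq_big_seq => q qs /=.
  by rewrite mcoeff_sqr_quartic //; apply: low.
exists s, c; split=> // i j; have [<-|ne] := eqVneq i j.
  by rewrite -diag; under eq_bigr do rewrite -expr2.
(* Doubling both sides turns [M i j] into a coefficient of the quartic, to be compared square by
   square. *)
rewrite -(ler_pMn2r (ltn0Sn 1)) -mcoeff_quartic_mixed // eq_s raddf_sum /=.
rewrite -sumrMnl big_seq [leRHS]big_seq; apply: ler_sum => q qs.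
by apply: mcoeff_sqr_mixed => //; apply: low.
Qed.

End Quartic.

(** * Closure properties of sums of squares *)

Section Sos.
Variables (R : realType) (n : nat).
Implicit Types p q : {mpoly R[n]}.

Lemma sos0 : is_sos (0 : {mpoly R[n]}).
Proof. by exists [::]; rewrite big_nil. Qed.

Lemma sosD p q : is_sos p -> is_sos q -> is_sos (p + q).
Proof. by move=> [s ->] [t ->]; exists (s ++ t); rewrite big_cat. Qed.

Lemma sos_sum (I : Type) (r : seq I) (P : pred I) (F : I -> {mpoly R[n]}) :
  (forall i, P i -> is_sos (F i)) -> is_sos (\sum_(i <- r | P i) F i).
Proof. by move=> sosF; apply: big_ind => //; [apply: sos0 | apply: sosD]. Qed.

Lemma sosZ_sqr (a : R) p : 0 <= a -> is_sos (a *: p ^+ 2).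
Proof.
move=> a_ge0; exists [:: Num.sqrt a *: p].
by rewrite big_seq1 exprZn sqr_sqrtr.
Qed.

End Sos.

(** * Stable sets, clique covers and components *)

Section Combinatorics.
Variables (n : nat) (G : sgraph n).
Implicit Types (u v x y : 'I_n) (S C : {set 'I_n}) (P : {set {set 'I_n}}).

Lemma stableP S :
  reflect {in S &, forall x y, ~~ G x y} (stable G S).
Proof.
apply: (iffP forall_inP) => [st x y xS|st x xS].
  by move/forall_inP: (st x xS); apply.
by apply/forall_inP => y; apply: st.
Qed.

Lemma cliqueP C :
  reflect {in C &, forall x y, x != y -> G x y} (clique G C).
Proof.
apply: (iffP forall_inP) => [cl x y xC yC|cl x xC].
  by move/forall_inP/(_ y yC)/implyP: (cl x xC).
by apply/forall_inP => y yC; apply/implyP; apply: cl.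
Qed.

Lemma leq_alpha S : stable G S -> (#|S| <= alpha G)%N.
Proof. exact: leq_bigmax_cond. Qed.

Lemma stable0 : stable G set0.
Proof. by apply/stableP => x y; rewrite inE. Qed.

Lemma alpha_witness : exists2 S, stable G S & #|S| = alpha G.
Proof.
have : (0 < #|[pred S | stable G S]|)%N.
  by apply/card_gt0P; exists set0; apply: stable0.
by move/(eq_bigmax_cond (fun S => #|S|)) => [S st eqS]; exists S.
Qed.

Lemma alpha_gt0 : (0 < n)%N -> (0 < alpha G)%N.
Proof.
move=> n_gt0; rewrite -(cards1 (Ordinal n_gt0)); apply: leq_alpha.
by apply/stableP => x y /set1P-> /set1P->; rewrite adj_irr.
Qed.

(** Sending each vertex to a clique containing it is injective on a stable set. The cliques may
    overlap; [pblock] just picks one. *)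
Lemma alpha_leq_cover P : clique_cover G P -> (alpha G <= #|P|)%N.
Proof.
case/andP=> /forall_inP clP /eqP covP.
have [S /stableP stS <-] := alpha_witness.
have inP x : pblock P x \in P by rewrite pblock_mem // covP inE.
have in_block x : x \in pblock P x by rewrite mem_pblock covP inE.
rewrite -(@card_in_imset _ _ (pblock P) S).
  by apply/subset_leq_card/subsetP => _ /imsetP[x _ ->].
move=> x y xS yS eq_xy; apply/eqP; apply: contraT => ne.
have := stS x y xS yS; rewrite (cliqueP _ (clP _ (inP x))) //.
by rewrite eq_xy.
Qed.

Lemma connect_adj_sym : connect_sym G.
Proof. by apply: sym_connect_sym; apply: adj_sym. Qed.

(** Choosing one root per component yields a stable set. *)
Lemma card_components_leq_alpha : (#|components G| <= alpha G)%N.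
Proof.
pose S := [set x | fingraph.roots G x].
apply: leq_trans (leq_alpha (S := S) _); last first.
  apply/stableP => x y; rewrite !inE => /eqP rx /eqP ry; apply/negP => xy.
  suff eq_xy : x = y by rewrite eq_xy adj_irr in xy.
  by rewrite -rx -ry; apply/eqP; rewrite fingraph.root_connect ?connect1 //;
    apply: connect_adj_sym.
apply: leq_trans (leq_imset_card (fun x => [set y | connect G x y]) S).
apply/subset_leq_card/subsetP => _ /imsetP[x _ ->]; apply/imsetP.
exists (fingraph.root G x).
  by rewrite inE roots_root //; apply: connect_adj_sym.
apply/setP => y; rewrite !inE; apply: same_connect; last exact: connect_root.
exact: connect_adj_sym.
Qed.

Lemma components_clique_cover :
  (forall C, C \in components G -> clique G C) ->
  clique_cover G (components G).
Proof.
move=> clC; apply/andP; split; first exact/forall_inP.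
apply/eqP/setP => x; rewrite [RHS]inE; apply/bigcupP.
by exists [set y | connect G x y]; [apply: imset_f | rewrite inE].
Qed.

Lemma clique_cover_number_witness :
  exists2 P, clique_cover G P & #|P| = clique_cover_number G.
Proof.
rewrite /clique_cover_number.
by case: arg_minnP => [|P covP _]; [apply: singletons_cover | exists P].
Qed.

Lemma clique_cover_number_leq P :
  clique_cover G P -> (clique_cover_number G <= #|P|)%N.
Proof.
rewrite /clique_cover_number => covP.
by case: arg_minnP => [|Q _]; [apply: singletons_cover | apply].
Qed.

Lemma alpha_leq_clique_cover_number : (alpha G <= clique_cover_number G)%N.
Proof.
by have [P covP <-] := clique_cover_number_witness; apply: alpha_leq_cover.
Qed.

(** The count is automatic: there are at most [alpha G] components, and at least as many when they
    form a clique cover. *)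
Lemma disjoint_union_of_cliquesP :
  disjoint_union_of_cliques G (alpha G) <->
  (forall x y, connect G x y -> x != y -> G x y).
Proof.
split=> [[clC _] x y cxy|cl].
  apply: (cliqueP [set y | connect G x y] _); rewrite ?inE ?connect0 //.
  by apply: clC; apply: imset_f.
have clC C : C \in components G -> clique G C.
  case/imsetP=> z _ ->; apply/cliqueP => x y; rewrite !inE => zx zy.
  by apply: cl; apply: connect_trans zy; rewrite connect_adj_sym.
split=> //; apply/eqP; rewrite eqn_leq card_components_leq_alpha.
exact/alpha_leq_cover/components_clique_cover.
Qed.

Lemma disjoint_union_of_cliques_cover_number :
  disjoint_union_of_cliques G (alpha G) -> clique_cover_number G = alpha G.
Proof.
case=> clC cardC; apply/eqP; rewrite eqn_leq alpha_leq_clique_cover_number.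
by rewrite -cardC clique_cover_number_leq // components_clique_cover.
Qed.

End Combinatorics.

(** Take [S] stable of size [alpha G + 1] after deletion of the edge. It must contain [u] and [v],
    and [T] is [S] without them. *)
Lemma critical_edge_exchange n (G : sgraph n) u v : critical_edge G u v ->
  exists T : {set 'I_n}, [/\ u \notin T, v \notin T,
    stable G (u |: T) /\ #|u |: T| = alpha G &
    stable G (v |: T) /\ #|v |: T| = alpha G].
Proof.
move=> [uv crit].
have neq_uv : u != v by apply: contraTneq uv => ->; rewrite adj_irr.
have [S stS cardS] := alpha_witness (del_edge G u v); rewrite crit in cardS.
have deleted x y : x \in S -> y \in S -> G x y -> [set x; y] = [set u; v].
  move=> xS yS xy; apply/eqP; apply: contraT => ne.
  by move/stableP/(_ x y xS yS): stS; rewrite /= /del_edge_rel xy ne.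
(* [S] is too large to be stable in [G], so it spans an edge of [G], necessarily the deleted one. *)
have /subsetP sub_uv : [set u; v] \subset S.
  have : ~~ stable G S by apply/negP => /leq_alpha; rewrite cardS ltnn.
  rewrite /stable negb_forall_in => /exists_inP[x xS].
  rewrite negb_forall_in => /exists_inP[y yS]; rewrite negbK => xy.
  by rewrite -(deleted x y xS yS xy); apply/subsetP => w /set2P[]->.
have uS := sub_uv u (set21 u v); have vS := sub_uv v (set22 u v).
exists (S :\ u :\ v).
have -> : u |: (S :\ u :\ v) = S :\ v.
  by rewrite setDDl [[set u] :|: [set v]]setUC -setDDl setD1K // !inE neq_uv.
have -> : v |: (S :\ u :\ v) = S :\ u.
  by rewrite setD1K // !inE eq_sym neq_uv.
have st w : w \in [set u; v] -> stable G (S :\ w).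
  move=> wuv; apply/stableP => x y; rewrite !inE => /andP[xw xS] /andP[yw yS].
  apply/negP => xy; move: wuv; rewrite -(deleted x y) // !inE.
  by rewrite ![w == _]eq_sym (negPf xw) (negPf yw).
have card w : w \in S -> #|S :\ w| = alpha G.
  by move=> wS; apply/eqP; rewrite -eqSS -cardS (cardsD1 w S) wS.
by rewrite !inE !eqxx andbF !st ?card // !inE eqxx ?orbT.
Qed.

(** * From sums of squares to cliques and back *)

Section ConeK.
Variables (R : realType) (n : nat) (G : sgraph n).
Local Notation M := (graph_mx R G).

Lemma graph_mxE i j :
  M i j = (alpha G)%:R * ((G i j)%:R + (i == j)%:R) - 1.
Proof. by rewrite !mxE. Qed.

Lemma graph_mx_sym : M^T = M.
Proof.
by apply/matrixP => i j; rewrite [LHS]mxE !graph_mxE adj_sym [j == i]eq_sym.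
Qed.

Lemma theta_rank_eq0 : theta_rank R G = Some 0%N <-> is_sos (quartic M).
Proof.
have -> : is_sos (quartic M) <-> coneK 0 M.
  rewrite /coneK expr0 mul1r; split=> [sosM|[]//].
  by split=> //; apply: graph_mx_sym.
rewrite /theta_rank; case: pselect => [exr|nexr].
  case: ex_minnP => r /asboolP Kr min_r; split=> [[<-]//|/asboolP K0].
  by congr Some; apply/eqP; rewrite -leqn0; apply: min_r.
by split=> // K0; case: nexr; exists 0%N; apply/asboolP.
Qed.

(** The sum over [q] of the squared sums is the Gram matrix summed over [S] times [S], hence at most
    the same sum for [M], which is zero. *)
Lemma gram_stable_sum (I : eqType) (s : seq I) (c : I -> 'I_n -> R) S :
    (forall i j, \sum_(q <- s) c q i * c q j <= M i j) ->
    stable G S -> #|S| = alpha G ->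
  forall q, q \in s -> \sum_(i in S) c q i = 0.
Proof.
move=> gram /stableP stS cardS; apply: sum_sqr_eq0.
apply/eqP; rewrite eq_le sumr_ge0 ?andbT => [|q _]; last exact: sqr_ge0.
(* Each row sums to [alpha G - #|S| = 0], as only the diagonal entry carries [alpha G]. *)
have sumM : \sum_(i in S) \sum_(j in S) M i j = 0.
  rewrite big1 // => i iS.
  rewrite (eq_bigr (fun j => (alpha G)%:R * (i == j)%:R - 1)); last first.
    by move=> j jS; rewrite graph_mxE (negPf (stS i j iS jS)) add0r.
  rewrite sumrB -mulr_sumr sumr_const cardS (bigD1 i) //= eqxx big1.
    by rewrite addr0 mulr1 subrr.
  by move=> j /andP[_ ne]; rewrite eq_sym (negPf ne).
have -> : \sum_(q <- s) (\sum_(i in S) c q i) ^+ 2 =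
          \sum_(i in S) \sum_(j in S) \sum_(q <- s) c q i * c q j.
  under eq_bigr do rewrite expr2 big_distrlr /=.
  by rewrite exchange_big; apply: eq_bigr => i _; rewrite exchange_big.
by rewrite -[leRHS]sumM; do 2!apply: ler_sum => ? _; apply: gram.
Qed.

Lemma gram_critical_eq (I : eqType) (s : seq I) (c : I -> 'I_n -> R) u v :
    (forall i j, \sum_(q <- s) c q i * c q j <= M i j) -> critical_edge G u v ->
  forall q, q \in s -> c q u = c q v.
Proof.
move=> gram /critical_edge_exchange[T [uT vT [stu cardu] [stv cardv]]] q qs.
have := etrans (gram_stable_sum gram stu cardu qs)
  (esym (gram_stable_sum gram stv cardv qs)).
by rewrite !big_setU1 //= => /addIr.
Qed.

Lemma sos_critical_disjoint_union :
    (0 < n)%N -> critical_graph G -> is_sos (quartic M) ->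
  disjoint_union_of_cliques G (alpha G).
Proof.
move=> n_gt0 crit /(sos_quartic_gram graph_mx_sym)[s [c [diag gram]]].
apply/disjoint_union_of_cliquesP => x y /connectP[p path_p ->] {y}.
have c_eq q : q \in s -> c q (last x p) = c q x.
  move=> qs; elim: p x path_p => //= y p IH x /andP[xy path_p].
  by rewrite IH // (gram_critical_eq gram (crit _ _ xy)).
set y := last x p in c_eq *; move=> ne; apply: contraT => nxy.
have := gram x y; rewrite graph_mxE (negPf nxy) (negPf ne) addr0 mulr0 sub0r.
have -> : \sum_(q <- s) c q x * c q y = M x x.
  by rewrite -diag; apply: eq_big_seq => q qs; rewrite c_eq // expr2.
(* The inequality now reads [alpha - 1 <= -1], against [alpha > 0]. *)
rewrite graph_mxE adj_irr eqxx add0r mulr1 lerBlDr addNr lern0.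
by rewrite -leqn0 leqNgt alpha_gt0.
Qed.

(* With [y C] the sum of the squares [X_i^2] over the block [C] of a cover by
   [alpha G] cliques, the form equals [1/2 sum (y C - y D)^2] plus terms
   [alpha X_i^2 X_j^2] over the edges [ij] between different blocks. *)
Lemma clique_cover_sos P :
  clique_cover G P -> #|P| = alpha G -> is_sos (quartic M).
Proof.
case/andP=> /forall_inP clP /eqP covP cardP.
pose z i : {mpoly R[n]} := 'X_i ^+ 2.
(* Choosing one clique per vertex turns the cover into a partition; a clique never chosen has
   [y C = 0]. *)
pose f := pblock P.
pose y C := \sum_(i | f i == C) z i.
have fP i : f i \in P by rewrite pblock_mem // covP inE.
have in_f i : i \in f i by rewrite mem_pblock covP inE.
have edge i j : f i = f j -> i != j -> G i j.
  by move=> eq ne; apply: (cliqueP _ _ (clP _ (fP i))); rewrite // eq in_f.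
pose a : R := (alpha G)%:R.
have sum_y : \sum_(C in P) y C = \sum_i z i.
  by rewrite [RHS](partition_big f (mem P)) //=; apply: eq_bigr.
have sum_y2 : \sum_(C in P) y C ^+ 2 =
    \sum_i \sum_j (f i == f j)%:R *: (z i * z j).
  rewrite [RHS](partition_big f (mem P)) //=; apply: eq_bigr => C _.
  rewrite expr2 big_distrlr /=; apply: eq_bigr => i /eqP fi.
  rewrite big_mkcond /=; apply: eq_bigr => j _; rewrite fi eq_sym.
  by case: eqP; rewrite ?scale1r ?scale0r.
have half C D : 2%:R^-1 *: (y C - y D) ^+ 2 =
    2%:R^-1 *: y C ^+ 2 + 2%:R^-1 *: y D ^+ 2 - y C * y D.
  rewrite sqrrB addrAC scalerDr scalerDr scalerN -scaler_nat scalerA.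
  by rewrite mulVf ?scale1r // pnatr_eq0.
(* Each half square [y C ^+ 2 / 2] occurs [#|P| = alpha G] times in either role. *)
have psd_part : \sum_(C in P) \sum_(D in P) 2%:R^-1 *: (y C - y D) ^+ 2 =
    a *: (\sum_(C in P) y C ^+ 2) - (\sum_(C in P) y C) ^+ 2.
  set T := \sum_(C in P) y C ^+ 2; set Y := \sum_(C in P) y C.
  have inner C : \sum_(D in P) 2%:R^-1 *: (y C - y D) ^+ 2 =
      a *: (2%:R^-1 *: y C ^+ 2) + 2%:R^-1 *: T - y C * Y.
    under eq_bigr do rewrite half.
    rewrite sumrB big_split sumr_const cardP /= -scaler_sumr -mulr_sumr.
    by rewrite scaler_nat.
  under eq_bigr do rewrite inner.
  rewrite sumrB big_split sumr_const cardP /= -!scaler_sumr.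
  rewrite -mulr_suml -/Y -/T -scaler_nat -/a -scalerDr -scalerDl.
  by rewrite -mulr2n -[_ *+ 2]mulr_natl mulfV ?scale1r ?expr2 // pnatr_eq0.
have -> : quartic M =
    \sum_(C in P) \sum_(D in P) 2%:R^-1 *: (y C - y D) ^+ 2
  + \sum_i \sum_j
      (a * ((G i j)%:R + (i == j)%:R - (f i == f j)%:R)) *: ('X_i * 'X_j) ^+ 2.
  rewrite psd_part sum_y sum_y2 expr2 big_distrlr /= scaler_sumr.
  rewrite -sumrB -big_split; apply: eq_bigr => i _ /=.
  rewrite scaler_sumr -sumrB -big_split; apply: eq_bigr => j _ /=.
  rewrite graph_mxE exprMn -/a -/(z i) -/(z j) scalerA.
  rewrite -[X in _ - X + _]scale1r -scalerBl -scalerDl; congr (_ *: _).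
  by rewrite mulrBr [RHS]addrC addrA subrK.
apply: sosD; do 2!apply: sos_sum => ? _; apply: sosZ_sqr.
  by rewrite invr_ge0 ler0n.
(* Nonnegative weights: two vertices of one block are equal or adjacent. *)
rewrite mulr_ge0 ?ler0n // subr_ge0 -natrD ler_nat.
case: eqVneq => [eq|_//]; case: eqVneq => [->|ne]; first by rewrite addn1.
by rewrite edge.
Qed.

End ConeK.

Local Close Scope ring_scope.

Theorem corollary5p3 (R : realType) (n : nat) (hn : 0 < n) (G : sgraph n)
    (hG : critical_graph G) :
  (theta_rank R G = Some 0 <-> disjoint_union_of_cliques G (alpha G)) /\
  (theta_rank R G = Some 0 <-> clique_cover_number G = alpha G).
Proof.
(* The three properties are linked by a cycle of implications. *)
have sos_du : theta_rank R G = Some 0 ->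
    disjoint_union_of_cliques G (alpha G).
  by move/theta_rank_eq0; apply: sos_critical_disjoint_union.
have du_cover := @disjoint_union_of_cliques_cover_number n G.
have cover_sos : clique_cover_number G = alpha G -> theta_rank R G = Some 0.
  have [P covP <-] := clique_cover_number_witness G.
  by move=> cardP; apply/theta_rank_eq0; apply: clique_cover_sos covP cardP.
by split; split=> [|?]; auto.
Qed.
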